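(* Let $0<q<1$, let $r,s$ be nonnegative integers and $a_1,\dots,a_r,b_1,\dots,b_s\ge 0$ real numbers. For $x>0$ set $$f(x)=\frac{\prod_{i=1}^{r}\Gamma_q(x+a_i)}{\prod_{j=1}^{s}\Gamma_q(x+b_j)},\qquad g(x)=(1-q)^{(r-s)x}f(x),\qquad \Upsilon=\sum_{i=1}^r q^{a_i}-\sum_{j=1}^s q^{b_j}.$$ Then there exists $M\ge 0$ such that $f$ and $g$ are both monotone on $(M,\infty)$. More specifically: (1) if $r>s$, then there is $M\ge 0$ such that $f$ is increasing for $x>M$; (2) if $r<s$, then there is $M\ge 0$ such that $f$ is decreasing for $x>M$; (3) if $\Upsilon<0$ (resp. $\Upsilon>0$), then there is $M\ge 0$ such that $g$ is increasing (resp. decreasing) for $x>M$.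
   Context: For $0<q<1$ and $x>0$, the $q$-gamma function is $\Gamma_q(x)=\frac{(q;q)_\infty}{(q^x;q)_\infty}(1-q)^{1-x}$, where $(a;q)_\infty=\prod_{k=0}^\infty(1-aq^k)$. Empty products equal $1$ and empty sums equal $0$. *)

(* Defs.v *)
From HB Require Import structures.
From mathcomp Require Import all_boot all_order all_algebra.
From mathcomp Require Import all_classical all_reals all_analysis.

Set Implicit Arguments.
Unset Strict Implicit.
Unset Printing Implicit Defensive.

Import Order.TTheory GRing.Theory Num.Theory.
Import numFieldNormedType.Exports.

Local Open Scope ring_scope.

(* The partial products converge for 0 < q < 1, so [limn] is then the actual
   value of the infinite product. *)
Definition qpochhammer_inf (R : realType) (a q : R) : R :=
  limn (fun n : nat => \prod_(0 <= k < n) (1 - a * q ^+ k)).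

Definition qgamma (R : realType) (q x : R) : R :=
  qpochhammer_inf q q / qpochhammer_inf (q `^ x) q * (1 - q) `^ (1 - x).

Definition qgamma_ratio (R : realType) (q : R) (r s : nat)
    (a : 'I_r -> R) (b : 'I_s -> R) (x : R) : R :=
  (\prod_(i < r) qgamma q (x + a i)) / (\prod_(j < s) qgamma q (x + b j)).

(* The exponent is the signed difference r - s, hence the subtraction in R. *)
Definition scaled_qgamma_ratio (R : realType) (q : R) (r s : nat)
    (a : 'I_r -> R) (b : 'I_s -> R) (x : R) : R :=
  (1 - q) `^ ((r%:R - s%:R) * x) * qgamma_ratio q a b x.

Definition Upsilon (R : realType) (q : R) (r s : nat)
    (a : 'I_r -> R) (b : 'I_s -> R) : R :=
  \sum_(i < r) q `^ a i - \sum_(j < s) q `^ b j.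

Definition increasing_beyond (R : realType) (M : R) (f : R -> R) : Prop :=
  {in `]M, +oo[ &, {homo f : x y / x < y}}.

Definition decreasing_beyond (R : realType) (M : R) (f : R -> R) : Prop :=
  {in `]M, +oo[ &, {homo f : x y / x < y >-> y < x}}.

(* Weak monotonicity: the ratio is constant when r = s and a = b. *)
Definition monotone_beyond (R : realType) (M : R) (f : R -> R) : Prop :=
  {in `]M, +oo[ &, {homo f : x y / x <= y}} \/
  {in `]M, +oo[ &, {homo f : x y / x <= y >-> y <= x}}.

(* Main.v *)
(* With t = q^x one has g(x) = K H(t), where K > 0 and H is the quotient of the
   products of (q^(b_j) t; q)_oo by those of (q^(a_i) t; q)_oo, and
   f(x) = (1 - q)^((s - r) x) g(x). Since H(t) = P(t) H(q t) with
   P(t) = prod_j (1 - q^(b_j) t) / prod_i (1 - q^(a_i) t), monotonicity of the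
   rational function P near 0 passes to H. The numerator of P' is a polynomial
   with value Upsilon at 0, hence it vanishes identically or has a constant sign
   on some interval (0, d). For r > s, log H is Lipschitz near t = 0, so along
   t = q^x its variation is negligible against the linear growth of
   (s - r) x log (1 - q). Exchanging a and b inverts f and g. *)
Require Import Defs.
From mathcomp Require Import all_boot all_order all_algebra.
From mathcomp Require Import all_classical all_reals all_analysis.
From mathcomp Require Import ring lra.

Import Order.TTheory GRing.Theory Num.Theory.
Import numFieldNormedType.Exports.

Set Implicit Arguments.
Unset Strict Implicit.
Unset Printing Implicit Defensive.

Local Open Scope ring_scope.

(** * The infinite product: convergence, recursion, bounds *)

Lemma qfactor_itv01 (R : realType) (q a : R) (k : nat) :
  0 < q < 1 -> 0 <= a <= 1 -> 0 <= 1 - a * q ^+ k <= 1.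
Proof.
move=> /andP[q0 q1] /andP[a0 a1].
have qk0 : 0 <= q ^+ k by rewrite exprn_ge0// ltW.
have qk1 : q ^+ k <= 1 by rewrite exprn_ile1// ltW.
apply/andP; split; last by rewrite gerBl mulr_ge0.
by rewrite subr_ge0 mulr_ile1.
Qed.

Lemma qpochhammer_cvg (R : realType) (q a : R) :
  0 < q < 1 -> 0 <= a <= 1 ->
  cvgn (fun n : nat => \prod_(0 <= k < n) (1 - a * q ^+ k)).
Proof.
move=> hq ha; have h k := qfactor_itv01 k hq ha.
apply: nonincreasing_is_cvgn.
  apply/nonincreasing_seqP => n; rewrite big_nat_recr//= ler_piMr//.
    by apply: prodr_ge0 => k _; case/andP: (h k).
  by case/andP: (h n).
by exists 0 => _ [n _ <-]; apply: prodr_ge0 => k _; case/andP: (h k).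
Qed.

(** Split off the factor k = 0 and shift the index in the limit. This yields the functional equation
    H(t) = P(t) H(q t). *)
Lemma qpochhammer_rec (R : realType) (q a : R) :
  0 < q < 1 -> 0 <= a <= 1 ->
  qpochhammer_inf a q = (1 - a) * qpochhammer_inf (a * q) q.
Proof.
move=> hq ha; have /andP[q0 q1] := hq; have /andP[a0 a1] := ha.
have haq : 0 <= a * q <= 1 by rewrite mulr_ge0 ?(ltW q0)//= mulr_ile1// ltW.
apply/cvg_lim => //; rewrite -cvg_shiftS/=.
have -> : (fun n => \prod_(0 <= k < n.+1) (1 - a * q ^+ k)) =
          (fun n => (1 - a) * \prod_(0 <= k < n) (1 - (a * q) * q ^+ k)).
  apply/funext => n; rewrite big_nat_recl// expr0 mulr1; congr (_ * _).
  by apply: eq_bigr => k _; rewrite exprS mulrA.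
by apply: cvgMr; exact: qpochhammer_cvg.
Qed.

Lemma qpochhammer_nonincreasing (R : realType) (q u t : R) :
  0 < q < 1 -> 0 <= u -> u <= t -> t <= 1 ->
  qpochhammer_inf t q <= qpochhammer_inf u q.
Proof.
move=> hq u0 ut t1; have /andP[q0 q1] := hq.
have t0 := le_trans u0 ut; have u1 := le_trans ut t1.
apply: ler_lim; [exact/qpochhammer_cvg/andP|exact/qpochhammer_cvg/andP|].
apply: nearW => n; apply: ler_prod => k _.
have /andP[-> _]/= := qfactor_itv01 k hq (introT andP (conj t0 t1)).
by rewrite lerD2l lerN2 ler_wpM2r// exprn_ge0// ltW.
Qed.

(* Factorwise, (1 - u q^k) / (1 - t q^k) <= 1 + (t - u) q^k / (1 - t). *)
Lemma qpochhammer_log_lipschitz (R : realType) (q u t : R) :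
  0 < q < 1 -> 0 <= u -> u <= t -> t < 1 ->
  qpochhammer_inf u q <=
    qpochhammer_inf t q * expR ((t - u) / ((1 - t) * (1 - q))).
Proof.
move=> hq u0 ut t1; have /andP[q0 q1] := hq.
have t0 := le_trans u0 ut; have u1 := le_lt_trans ut t1.
have ct := qpochhammer_cvg hq (introT andP (conj t0 (ltW t1))).
have cu := qpochhammer_cvg hq (introT andP (conj u0 (ltW u1))).
set C := expR _.
have <- : limn (fun n : nat => \prod_(0 <= k < n) (1 - t * q ^+ k) * C) =
    qpochhammer_inf t q * C by apply/cvg_lim => //; apply: cvgMl; exact: ct.
apply: ler_lim; [exact: cu|by apply: is_cvgMl; exact: ct|].
apply: nearW => n.
have h k := qfactor_itv01 k hq (introT andP (conj t0 (ltW t1))).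
have hu k := qfactor_itv01 k hq (introT andP (conj u0 (ltW u1))).
pose d := (t - u) / (1 - t).
have d0 : 0 <= d by rewrite divr_ge0// subr_ge0// ltW.
(* The exponents form a geometric series with partial sums at most d / (1 - q), so [C] bounds the
   product for every n. *)
have hC : \prod_(0 <= k < n) expR (d * q ^+ k) <= C.
  rewrite -expR_sum ler_expR -mulr_sumr invfM mulrA ler_wpM2l//.
  have := geometric_le_lim n (@ler01 R) q0; rewrite gtr0_norm// => /(_ q1).
  rewrite mul1r; apply: le_trans; rewrite /series/=.
  by apply: ler_sum => k _; rewrite mul1r.
apply: (@le_trans _ _ (\prod_(0 <= k < n) ((1 - t * q ^+ k) * expR (d * q ^+ k)))).
  apply: ler_prod => k _; have /andP[-> _]/= := hu k.
  have qk0 : 0 <= q ^+ k by rewrite exprn_ge0// ltW.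
  have qk1 : q ^+ k <= 1 by rewrite exprn_ile1// ltW.
  apply: (@le_trans _ _ ((1 - t * q ^+ k) * (1 + d * q ^+ k))); last first.
    by rewrite ler_wpM2l ?expR_ge1Dx//; case/andP: (h k).
  have -> : (1 - t * q ^+ k) * (1 + d * q ^+ k) = (1 - u * q ^+ k) +
      d * q ^+ k * t * (1 - q ^+ k).
    by rewrite /d; field; rewrite subr_eq0 gt_eqF.
  by rewrite lerDl mulr_ge0 ?subr_ge0// mulr_ge0// mulr_ge0.
rewrite big_split/= ler_wpM2l//.
by apply: prodr_ge0 => k _; case/andP: (h k).
Qed.

Lemma qpochhammer0 (R : realType) (q : R) : qpochhammer_inf 0 q = 1.
Proof.
apply/cvg_lim => //; have -> : (fun n => \prod_(0 <= k < n) (1 - 0 * q ^+ k)) =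
  (fun=> 1) by apply/funext => n; rewrite big1// => k _; rewrite mul0r subr0.
exact: cvg_cst.
Qed.

(** A limit of positive partial products could be 0. The Lipschitz bound with u = 0 excludes this,
    since it gives 1 <= (t; q)_oo * exp(...). *)
Lemma qpochhammer_gt0 (R : realType) (q t : R) :
  0 < q < 1 -> 0 <= t -> t < 1 -> 0 < qpochhammer_inf t q.
Proof.
move=> hq t0 t1.
have := qpochhammer_log_lipschitz hq (lexx 0) t0 t1.
rewrite qpochhammer0 => /(lt_le_trans ltr01).
by rewrite pmulr_lgt0// expR_gt0.
Qed.

(** * Sign of a polynomial to the right of 0 *)

Lemma poly_gt0_near0 (R : realType) (p : {poly R}) :
  0 < p.[0] -> exists2 d : R, 0 < d & forall t, 0 < t < d -> 0 < p.[t].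
Proof.
move=> p0.
have /nbhs_ballP[d /= d0 hd] : \forall t \near (0 : R), 0 < p.[t].
  exact: (cvgr_gt p.[0] (@continuous_horner R p 0) 0 p0).
exists d => // t /andP[t0 td].
by apply: hd; rewrite /ball/= sub0r normrN gtr0_norm.
Qed.

(** Write p = p1 * X^m with p1(0) nonzero. For t > 0 the factor t^m is positive, so p has the sign
    of p1, which by continuity is that of p1(0) near 0. *)
Lemma poly_sgn_near0 (R : realType) (p : {poly R}) :
  p != 0 -> exists2 d : R, 0 < d &
    (forall t, 0 < t < d -> 0 < p.[t]) \/ (forall t, 0 < t < d -> p.[t] < 0).
Proof.
move=> pn0; have [m [p1 + pE]] := multiplicity_XsubC p 0.
rewrite pn0/= /root => p10.
have pt t : p.[t] = p1.[t] * t ^+ m.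
  by rewrite pE hornerM horner_exp hornerXsubC subr0.
have [p1_gt0|p1_lt0|p1_eq0] := ltgtP 0 p1.[0]; last by rewrite -p1_eq0 eqxx in p10.
  have [d d0 hd] := poly_gt0_near0 p1_gt0; exists d => //; left => t td.
  by rewrite pt mulr_gt0 ?hd// exprn_gt0//; case/andP: td.
have p1N : 0 < (- p1).[0] by rewrite hornerN oppr_gt0.
have [d d0 hd] := poly_gt0_near0 p1N; exists d => //; right => t td.
rewrite pt pmulr_llt0; last by rewrite exprn_gt0//; case/andP: td.
by rewrite -oppr_gt0 -hornerN hd.
Qed.

(** * The rational function P and the numerator of its derivative *)

Definition linear_prod (R : realType) (r : nat) (al : 'I_r -> R) : {poly R} :=
  \prod_(i < r) (1 - al i *: 'X).

(** Numerator of the derivative of P = [linear_prod be] / [linear_prod al]. Being a polynomial, it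
    cannot change sign infinitely often near 0. *)
Definition wronskian (R : realType) (r s : nat)
    (al : 'I_r -> R) (be : 'I_s -> R) : {poly R} :=
  (linear_prod be)^`() * linear_prod al -
  linear_prod be * (linear_prod al)^`().

Lemma linear_prodE (R : realType) (r : nat) (al : 'I_r -> R) (t : R) :
  (linear_prod al).[t] = \prod_(i < r) (1 - al i * t).
Proof.
by rewrite horner_prod; apply: eq_bigr => i _; rewrite !hornerE.
Qed.

Lemma linear_prod_gt0 (R : realType) (r : nat) (al : 'I_r -> R) (t : R) :
  (forall i, 0 < al i <= 1) -> 0 <= t < 1 -> 0 < (linear_prod al).[t].
Proof.
move=> hal /andP[t0 t1]; rewrite linear_prodE; apply: prodr_gt0 => i _.
have /andP[a0 a1] := hal i.
by rewrite subr_gt0; apply: le_lt_trans t1; rewrite ler_piMl.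
Qed.

(** The two values are proved together because the product rule in the induction step uses the value
    at 0. *)
Lemma linear_prod_deriv0 (R : realType) (r : nat) (al : 'I_r -> R) :
  (linear_prod al).[0] = 1 /\
  (linear_prod al)^`().[0] = - \sum_(i < r) al i.
Proof.
rewrite /linear_prod; elim/big_rec2: _ => [|i s p _ [p0 p0']].
  by rewrite -polyC1 derivC hornerC horner0 oppr0.
rewrite derivM !hornerE/= p0 p0' derivB derivZ derivX -polyC1 derivC !hornerE.
by split; ring.
Qed.

(** For al i = q^(a i) and be j = q^(b j) the right-hand side is [Upsilon], which is how it governs
    the monotonicity of g. *)
Lemma wronskian_at0 (R : realType) (r s : nat)
    (al : 'I_r -> R) (be : 'I_s -> R) :
  (wronskian al be).[0] = \sum_i al i - \sum_j be j.
Proof.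
have [a0 a0'] := linear_prod_deriv0 al.
have [b0 b0'] := linear_prod_deriv0 be.
by rewrite /wronskian !hornerE a0 a0' b0 b0'; ring.
Qed.

Lemma wronskian_sym (R : realType) (r s : nat)
    (al : 'I_r -> R) (be : 'I_s -> R) :
  wronskian be al = - wronskian al be.
Proof. by rewrite /wronskian opprB; congr (_ - _); rewrite mulrC. Qed.

Definition linear_quot (R : realType) (r s : nat)
    (al : 'I_r -> R) (be : 'I_s -> R) (t : R) : R :=
  (\prod_(j < s) (1 - be j * t)) / (\prod_(i < r) (1 - al i * t)).

Lemma linear_quot_gt0 (R : realType) (r s : nat)
    (al : 'I_r -> R) (be : 'I_s -> R) (t : R) :
  (forall i, 0 < al i <= 1) -> (forall j, 0 < be j <= 1) -> 0 <= t < 1 ->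
  0 < linear_quot al be t.
Proof.
by move=> hal hbe ht; rewrite /linear_quot -!linear_prodE divr_gt0// linear_prod_gt0.
Qed.

Lemma is_derive_horner_div (R : realType) (A B : {poly R}) (z : R) :
  A.[z] != 0 ->
  is_derive z (1 : R) (fun z => B.[z] / A.[z])
    ((B^`() * A - B * A^`()).[z] / A.[z] ^+ 2).
Proof.
move=> An0; have dV := is_deriveV An0 (is_derive_poly A z).
have dM := is_deriveM (is_derive_poly B z) dV.
apply: (is_derive_eq dM); rewrite hornerD hornerN !hornerM.
rewrite /GRing.scale/=.
move: An0 B.[z] A^`().[z] B^`().[z]; move: (A.[z]) => x x0 y dx dy.
by field.
Qed.

(** Mean value theorem in which the positive factor w = (t - u) / A(c)^2 is left abstract: only the
    sign of the increment is used later. *)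
Lemma horner_div_MVT (R : realType) (A B : {poly R}) (u t : R) :
  (forall z, u <= z <= t -> 0 < A.[z]) -> u < t ->
  exists2 c, u < c < t & exists2 w, 0 < w &
    B.[t] / A.[t] - B.[u] / A.[u] = (B^`() * A - B * A^`()).[c] * w.
Proof.
move=> A0 ut.
have dq z : z \in `[u, t] -> is_derive z (1 : R) (fun z => B.[z] / A.[z])
    ((B^`() * A - B * A^`()).[z] / A.[z] ^+ 2).
  rewrite in_itv/= => /A0 Az; apply: is_derive_horner_div.
  by rewrite gt_eqF.
have dq' z : z \in `]u, t[ -> is_derive z (1 : R) (fun z => B.[z] / A.[z])
    ((B^`() * A - B * A^`()).[z] / A.[z] ^+ 2).
  by move=> zut; apply: dq; apply: subset_itv_oo_cc zut.
have cq : {within `[u, t], continuous (fun z => B.[z] / A.[z])}%classic.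
  by apply: derivable_within_continuous => z /dq [].
have [c + ->] := MVT ut dq' cq.
rewrite in_itv/= => /andP[uc ct]; exists c; first by rewrite uc ct.
exists ((t - u) / A.[c] ^+ 2); last by rewrite -mulrA [_^-1 * _]mulrC.
by rewrite divr_gt0 ?subr_gt0// exprn_gt0// A0// !ltW.
Qed.

Lemma linear_quot_MVT (R : realType) (r s : nat)
    (al : 'I_r -> R) (be : 'I_s -> R) (u t : R) :
  (forall i, 0 < al i <= 1) -> 0 < u -> u < t -> t < 1 ->
  exists2 c, u < c < t & exists2 w, 0 < w &
    linear_quot al be t - linear_quot al be u = (wronskian al be).[c] * w.
Proof.
move=> hal u0 ut t1; rewrite /linear_quot -!linear_prodE.
apply: horner_div_MVT => // z /andP[uz zt]; apply: linear_prod_gt0 => //.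
by rewrite (le_trans (ltW u0) uz) (le_lt_trans zt t1).
Qed.

(** * The quotient H: recursion, Lipschitz bound, transfer of monotonicity from P *)

Definition qpochhammer_prod (R : realType) (q : R) (r : nat)
    (al : 'I_r -> R) (t : R) : R :=
  \prod_(i < r) qpochhammer_inf (al i * t) q.

(** This is H. The family [be] stands on top because the q-gamma function has its x-dependent
    product in the denominator. *)
Definition qpochhammer_quot (R : realType) (q : R) (r s : nat)
    (al : 'I_r -> R) (be : 'I_s -> R) (t : R) : R :=
  qpochhammer_prod q be t / qpochhammer_prod q al t.

Lemma qpochhammer_prod_gt0 (R : realType) (q : R) (r : nat)
    (al : 'I_r -> R) (t : R) :
  0 < q < 1 -> (forall i, 0 < al i <= 1) -> 0 <= t < 1 ->
  0 < qpochhammer_prod q al t.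
Proof.
move=> hq hal /andP[t0 t1]; apply: prodr_gt0 => i _.
have /andP[a0 a1] := hal i; apply: qpochhammer_gt0 => //.
  by rewrite mulr_ge0// ltW.
by apply: le_lt_trans t1; rewrite ler_piMl.
Qed.

Lemma qpochhammer_quot_gt0 (R : realType) (q : R) (r s : nat)
    (al : 'I_r -> R) (be : 'I_s -> R) (t : R) :
  0 < q < 1 -> (forall i, 0 < al i <= 1) -> (forall j, 0 < be j <= 1) ->
  0 <= t < 1 -> 0 < qpochhammer_quot q al be t.
Proof. by move=> hq hal hbe ht; rewrite divr_gt0// qpochhammer_prod_gt0. Qed.

Lemma qpochhammer_quot_rec (R : realType) (q : R) (r s : nat)
    (al : 'I_r -> R) (be : 'I_s -> R) (t : R) :
  0 < q < 1 -> (forall i, 0 < al i <= 1) -> (forall j, 0 < be j <= 1) ->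
  0 <= t < 1 ->
  qpochhammer_quot q al be t =
    linear_quot al be t * qpochhammer_quot q al be (t * q).
Proof.
move=> hq hal hbe /andP[t0 t1].
have H n (ga : 'I_n -> R) : (forall i, 0 < ga i <= 1) ->
    qpochhammer_prod q ga t =
    (\prod_(i < n) (1 - ga i * t)) * qpochhammer_prod q ga (t * q).
  move=> hga; rewrite -big_split/=; apply: eq_bigr => i _.
  have /andP[g0 g1] := hga i; rewrite mulrA; apply: qpochhammer_rec => //.
  by rewrite mulr_ge0 ?(ltW g0)//= mulr_ile1 ?(ltW g0)// ltW.
rewrite /qpochhammer_quot !H// /linear_quot invfM.
by rewrite mulrACA.
Qed.

(** From u to t the numerator can only decrease, while each of the r factors of the denominator
    shrinks by at most one exponential; hence the coefficient r. *)
Lemma qpochhammer_quot_lipschitz (R : realType) (q : R) (r s : nat)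
    (al : 'I_r -> R) (be : 'I_s -> R) (u t : R) :
  0 < q < 1 -> (forall i, 0 < al i <= 1) -> (forall j, 0 < be j <= 1) ->
  0 <= u -> u <= t -> t < 1 ->
  qpochhammer_quot q al be t <= qpochhammer_quot q al be u *
    expR (r%:R * ((t - u) / ((1 - t) * (1 - q)))).
Proof.
move=> hq hal hbe u0 ut t1; have /andP[q0 q1] := hq.
have t0 := le_trans u0 ut; have u1 := le_lt_trans ut t1.
set C := (t - u) / _.
have At : 0 < qpochhammer_prod q al t by rewrite qpochhammer_prod_gt0// t0.
have Au : 0 < qpochhammer_prod q al u by rewrite qpochhammer_prod_gt0// u0.
have Bt : 0 < qpochhammer_prod q be t by rewrite qpochhammer_prod_gt0// t0.
have leB : qpochhammer_prod q be t <= qpochhammer_prod q be u.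
  apply: ler_prod => j _; have /andP[b0 b1] := hbe j.
  have bt1 : be j * t <= 1 by rewrite mulr_ile1 ?(ltW b0)// ltW.
  rewrite qpochhammer_nonincreasing ?mulr_ge0 ?(ltW b0)// ?ler_wpM2l ?(ltW b0)//.
  rewrite andbT ltW// qpochhammer_gt0// ?mulr_ge0 ?(ltW b0)//.
  by apply: le_lt_trans t1; rewrite ler_piMl.
have leA : qpochhammer_prod q al u <= qpochhammer_prod q al t * expR (r%:R * C).
  have -> : expR (r%:R * C) = \prod_(i < r) expR C.
    by rewrite prodr_const card_ord expRM_natl.
  rewrite -big_split/=; apply: ler_prod => i _; have /andP[a0 a1] := hal i.
  have au_ge0 : 0 <= al i * u by rewrite mulr_ge0// ltW.
  have at_le : al i * t <= t by rewrite ler_piMl.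
  have au_le : al i * u <= u by rewrite ler_piMl.
  have au_at : al i * u <= al i * t by rewrite ler_wpM2l// ltW.
  have at1 := le_lt_trans at_le t1.
  rewrite (ltW (qpochhammer_gt0 hq au_ge0 (le_lt_trans au_le u1)))/=.
  apply: le_trans (qpochhammer_log_lipschitz hq au_ge0 au_at at1) _.
  rewrite ler_wpM2l ?ler_expR//.
    by rewrite ltW// qpochhammer_gt0// (le_trans au_ge0).
  (* Since al i <= 1, passing from (al i * u, al i * t) to (u, t) enlarges both t - u and 1 / (1 -
     t), so one constant serves all i. *)
  rewrite /C !invfM !mulrA ler_wpM2r ?invr_ge0 ?subr_ge0 ?(ltW q1)//.
  rewrite ler_pM ?subr_ge0 ?invr_ge0 ?subr_ge0 ?(ltW at1)//.
    by rewrite -mulrBr ler_piMl// subr_ge0.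
  by rewrite lef_pV2 ?posrE ?subr_gt0// lerD2l lerN2.
rewrite /qpochhammer_quot ler_pdivrMr// -!mulrA.
have Bu := le_trans (ltW Bt) leB.
apply: (le_trans leB); rewrite ler_peMr// mulrC ler_pdivlMr// mul1r mulrC.
exact: leA.
Qed.

(* H(t) / H(u) = (prod_(k < n) P(t q^k) / P(u q^k)) * H(t q^n) / H(u q^n), and
   the last quotient tends to 1. *)
Lemma qpochhammer_quot_nonincreasing (R : realType) (q : R) (r s : nat)
    (al : 'I_r -> R) (be : 'I_s -> R) (d : R) :
  0 < q < 1 -> (forall i, 0 < al i <= 1) -> (forall j, 0 < be j <= 1) ->
  d <= 1 ->
  (forall u t, 0 < u -> u < t -> t < d ->
     linear_quot al be t <= linear_quot al be u) ->
  forall u t, 0 < u -> u < t -> t < d ->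
    qpochhammer_quot q al be t <= qpochhammer_quot q al be u.
Proof.
move=> hq hal hbe d1 hP u t u0 ut td; have /andP[q0 q1] := hq.
pose K := r%:R * ((t - u) / ((1 - t) * (1 - q))).
have t1 := lt_le_trans td d1.
(* The two points are quantified inside the induction because its hypothesis is applied at u' q and
   t' q. *)
have step n : forall u' t', 0 < u' -> u' < t' -> t' < d ->
  qpochhammer_quot q al be t' <= qpochhammer_quot q al be u' *
  expR (r%:R * ((t' * q ^+ n - u' * q ^+ n) / ((1 - t' * q ^+ n) * (1 - q)))).
  elim: n => [|n IHn] v z v0 vz zd.
    by rewrite expr0 !mulr1; apply: qpochhammer_quot_lipschitz => //;
      rewrite ?ltW// (lt_le_trans zd).
  have z0 := lt_trans v0 vz; have z1 := lt_le_trans zd d1.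
  have zq : z * q <= z by apply: ler_piMr; exact: ltW.
  have v1 := lt_trans vz z1.
  have hv : 0 <= v < 1 by rewrite v1 (ltW v0).
  have hz : 0 <= z < 1 by rewrite z1 (ltW z0).
  rewrite (qpochhammer_quot_rec hq hal hbe hz) (qpochhammer_quot_rec hq hal hbe hv).
  rewrite -mulrA ler_pM//.
  - by rewrite ltW// linear_quot_gt0.
  - rewrite ltW// qpochhammer_quot_gt0// mulr_ge0 ?ltW//=.
    exact: le_lt_trans zq z1.
  - exact: hP.
  rewrite exprS (mulrA z) (mulrA v); apply: IHn.
  - by rewrite mulr_gt0.
  - by rewrite ltr_pM2r.
  - exact: le_lt_trans zq zd.
have Hu : 0 < qpochhammer_quot q al be u.
  by rewrite qpochhammer_quot_gt0// ltW//= (lt_trans ut).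
(* As 1 - t q^n >= 1 - t, the exponent of [step] is at most K q^n with K independent of n, and this
   tends to 0. *)
have bound n : qpochhammer_quot q al be t <=
    qpochhammer_quot q al be u * expR (K * q ^+ n).
  apply: le_trans (step n _ _ u0 ut td) _.
  rewrite ler_pM2l// ler_expR /K -[leRHS]mulrA ler_wpM2l//.
  have qn0 : 0 <= q ^+ n by rewrite exprn_ge0 ?ltW.
  have qn1 : q ^+ n <= 1 by rewrite exprn_ile1 ?ltW.
  have tq : t * q ^+ n <= t by rewrite ler_piMr// ltW// (lt_trans u0).
  rewrite -mulrBl -[leRHS]mulrA -[leLHS]mulrA.
  rewrite ler_wpM2l ?subr_ge0 ?(ltW ut)// [leRHS]mulrC ler_wpM2l//.
  rewrite lef_pV2 ?posrE ?mulr_gt0 ?subr_gt0 ?(le_lt_trans tq t1)//.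
  by rewrite ler_wpM2r ?subr_ge0 ?(ltW q1)// lerD2l lerN2.
have cv : ((fun n : nat => qpochhammer_quot q al be u * expR (K * q ^+ n))
    @ \oo --> qpochhammer_quot q al be u * expR (K * 0))%classic.
  apply: cvgMr; apply: continuous_cvg; first exact: continuous_expR.
  by apply: cvgMr; apply: cvg_expr; rewrite gtr0_norm.
rewrite mulr0 expR0 mulr1 in cv.
rewrite -(cvg_lim _ cv)//; apply: limr_ge; last exact: nearW.
by apply/cvg_ex; eexists; exact: cv.
Qed.

(** A passage to the limit loses strictness. It is recovered by using the recursion once: the factor
    P decreases strictly, and the weak result handles H at t q and u q. *)
Lemma qpochhammer_quot_decreasing (R : realType) (q : R) (r s : nat)
    (al : 'I_r -> R) (be : 'I_s -> R) (d : R) :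
  0 < q < 1 -> (forall i, 0 < al i <= 1) -> (forall j, 0 < be j <= 1) ->
  d <= 1 ->
  (forall u t, 0 < u -> u < t -> t < d ->
     linear_quot al be t < linear_quot al be u) ->
  forall u t, 0 < u -> u < t -> t < d ->
    qpochhammer_quot q al be t < qpochhammer_quot q al be u.
Proof.
move=> hq hal hbe d1 hP u t u0 ut td; have /andP[q0 q1] := hq.
have t0 := lt_trans u0 ut; have t1 := lt_le_trans td d1.
have tq : t * q <= t by apply: ler_piMr; exact: ltW.
have ht : 0 <= t < 1 by rewrite t1 (ltW t0).
have hu : 0 <= u < 1 by rewrite (ltW u0) (lt_trans ut t1).
rewrite (qpochhammer_quot_rec hq hal hbe ht) (qpochhammer_quot_rec hq hal hbe hu).
have htq : 0 <= t * q < 1 by rewrite mulr_ge0 ?ltW//= (le_lt_trans tq).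
apply: (@lt_le_trans _ _ (linear_quot al be u * qpochhammer_quot q al be (t * q))).
  by rewrite ltr_pM2r ?hP// qpochhammer_quot_gt0.
rewrite ler_pM2l ?linear_quot_gt0//.
apply: (qpochhammer_quot_nonincreasing hq hal hbe d1).
- by move=> *; apply/ltW/hP.
- by rewrite mulr_gt0.
- by rewrite ltr_pM2r.
- exact: le_lt_trans tq td.
Qed.

(** * The substitution t = q^x *)

Lemma powR_itv01 (R : realType) (q x : R) :
  0 < q < 1 -> 0 <= x -> 0 < q `^ x <= 1.
Proof.
move=> /andP[q0 q1] x0; rewrite powR_gt0//= /powR gt_eqF//.
by rewrite -expR0 ler_expR mulr_ge0_le0// ln_le0// ltW.
Qed.

Lemma powR_decreasing01 (R : realType) (q x y : R) :
  0 < q < 1 -> x < y -> q `^ y < q `^ x.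
Proof.
move=> /andP[q0 q1] xy; rewrite /powR gt_eqF// ltr_expR ltr_nM2r//.
by rewrite ln_lt0// q0.
Qed.

Lemma powR_eventually_lt (R : realType) (q d : R) :
  0 < q < 1 -> 0 < d ->
  exists2 M : R, 0 <= M & forall x, M < x -> q `^ x < d.
Proof.
move=> /andP[q0 q1] d0; have lq : ln q < 0 by rewrite ln_lt0// q0.
(* The solution of q^x = d, cut off at 0; dividing by ln q < 0 reverses the inequality. *)
exists (Num.max 0 (ln d / ln q)); first by rewrite le_max lexx.
move=> x; rewrite gt_max => /andP[_ hx].
by rewrite /powR gt_eqF// -[ltRHS](lnK (x := d))// ltr_expR -ltr_ndivrMr.
Qed.

(** * The ratios f and g in the variable t = q^x *)

Lemma qgammaE (R : realType) (q a x : R) :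
  0 < q < 1 ->
  qgamma q (x + a) = qpochhammer_inf q q * (1 - q) `^ (1 - a) *
    ((1 - q) `^ x)^-1 / qpochhammer_inf (q `^ a * q `^ x) q.
Proof.
move=> /andP[q0 q1]; have q1' : 1 - q != 0 by rewrite subr_eq0 gt_eqF.
rewrite /qgamma [x + a]addrC powRD ?(gt_eqF q0) ?implybT// opprD addrA.
by rewrite powRD ?q1' ?implybT// powRN; ring.
Qed.

Lemma prod_qgammaE (R : realType) (q : R) (r : nat) (a : 'I_r -> R) :
  0 < q < 1 -> exists2 c, 0 < c & forall x,
    \prod_(i < r) qgamma q (x + a i) =
    c * ((1 - q) `^ (r%:R * x))^-1 /
      qpochhammer_prod q (fun i => q `^ a i) (q `^ x).
Proof.
move=> hq; have /andP[q0 q1] := hq.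
exists (\prod_(i < r) (qpochhammer_inf q q * (1 - q) `^ (1 - a i))).
  apply: prodr_gt0 => i _; rewrite mulr_gt0 ?powR_gt0 ?subr_gt0//.
  by rewrite qpochhammer_gt0// ltW.
move=> x; rewrite mulrC powRrM powRAC powR_mulrn ?powR_ge0// -exprVn.
rewrite -[X in _ ^+ X](card_ord r) -prodr_const -prodfV -!big_split/=.
by apply: eq_bigr => i _; rewrite qgammaE// [RHS]mulrC.
Qed.

Lemma qgamma_ratio_scaled (R : realType) (q : R) (r s : nat)
    (a : 'I_r -> R) (b : 'I_s -> R) (x : R) :
  0 < q < 1 ->
  qgamma_ratio q a b x =
    (1 - q) `^ ((s%:R - r%:R) * x) * scaled_qgamma_ratio q a b x.
Proof.
move=> /andP[q0 q1]; have q1' : 1 - q != 0 by rewrite subr_eq0 gt_eqF.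
rewrite /scaled_qgamma_ratio mulrA -powRD ?q1' ?implybT//.
by rewrite -mulrDl addrA subrK subrr mul0r powRr0 mul1r.
Qed.

(** The numerator of f contributes (1 - q)^(-r x) and the denominator (1 - q)^(s x); the scaling in
    g cancels exactly these. The constant stays abstract, as its positivity suffices for
    monotonicity. *)
Lemma scaled_qgamma_ratioE (R : realType) (q : R) (r s : nat)
    (a : 'I_r -> R) (b : 'I_s -> R) :
  0 < q < 1 -> exists2 c, 0 < c & forall x,
    scaled_qgamma_ratio q a b x =
    c * qpochhammer_quot q (fun i => q `^ a i) (fun j => q `^ b j) (q `^ x).
Proof.
move=> hq; have /andP[q0 q1] := hq.
have q1' : 1 - q != 0 by rewrite subr_eq0 gt_eqF.
have [ca ca0 Ea] := prod_qgammaE a hq; have [cb cb0 Eb] := prod_qgammaE b hq.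
exists (ca / cb); first by rewrite divr_gt0.
move=> x; rewrite /scaled_qgamma_ratio /qgamma_ratio Ea Eb mulrBl.
rewrite powRD ?q1' ?implybT// powRN /qpochhammer_quot !invfM !invrK.
have wr : (1 - q) `^ (r%:R * x) != 0 by rewrite gt_eqF// powR_gt0// subr_gt0.
have ws : (1 - q) `^ (s%:R * x) != 0 by rewrite gt_eqF// powR_gt0// subr_gt0.
move: ((1 - q) `^ (r%:R * x)) wr ((1 - q) `^ (s%:R * x)) ws => w w0 v v0.
transitivity ((w / w) * (v / v) * (ca / cb * (qpochhammer_prod q (fun j => q `^ b j) (q `^ x) /
   qpochhammer_prod q (fun j => q `^ a j) (q `^ x)))); first by ring.
by rewrite !divff// !mul1r.
Qed.

Lemma scaled_qgamma_ratio_gt0 (R : realType) (q : R) (r s : nat)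
    (a : 'I_r -> R) (b : 'I_s -> R) (x : R) :
  0 < q < 1 -> (forall i, 0 <= a i) -> (forall j, 0 <= b j) -> 0 < x ->
  0 < scaled_qgamma_ratio q a b x.
Proof.
move=> hq ha hb x0; have [c c0 ->] := scaled_qgamma_ratioE a b hq.
rewrite mulr_gt0// qpochhammer_quot_gt0//.
- by move=> i; rewrite powR_itv01.
- by move=> i; rewrite powR_itv01.
by rewrite powR_ge0/= -[ltRHS](powRr0 q) powR_decreasing01.
Qed.

Lemma qgamma_ratio_gt0 (R : realType) (q : R) (r s : nat)
    (a : 'I_r -> R) (b : 'I_s -> R) (x : R) :
  0 < q < 1 -> (forall i, 0 <= a i) -> (forall j, 0 <= b j) -> 0 < x ->
  0 < qgamma_ratio q a b x.
Proof.
move=> hq ha hb x0; rewrite qgamma_ratio_scaled// mulr_gt0//.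
  by rewrite powR_gt0// subr_gt0; case/andP: hq.
exact: scaled_qgamma_ratio_gt0.
Qed.

(** * Exchange of the two families, and monotonicity on rays *)

Lemma qgamma_ratio_swap (R : realType) (q : R) (r s : nat)
    (a : 'I_r -> R) (b : 'I_s -> R) (x : R) :
  qgamma_ratio q b a x = (qgamma_ratio q a b x)^-1.
Proof. by rewrite /qgamma_ratio invf_div. Qed.

Lemma scaled_qgamma_ratio_swap (R : realType) (q : R) (r s : nat)
    (a : 'I_r -> R) (b : 'I_s -> R) (x : R) :
  scaled_qgamma_ratio q b a x = (scaled_qgamma_ratio q a b x)^-1.
Proof.
by rewrite /scaled_qgamma_ratio qgamma_ratio_swap [RHS]invfM -powRN -mulNr opprB.
Qed.

(** Used with g the ratio for exchanged families, so that each decreasing case follows from an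
    increasing one. *)
Lemma decreasing_beyondV (R : realType) (M : R) (f g : R -> R) :
  (forall x, M < x -> 0 < g x) -> (forall x, f x = (g x)^-1) ->
  increasing_beyond M g -> decreasing_beyond M f.
Proof.
move=> g0 fg ginc x y xM yM xy; rewrite !fg ltf_pV2 ?posrE; first exact: ginc.
- by move: yM; rewrite in_itv/= andbT; exact: g0.
- by move: xM; rewrite in_itv/= andbT; exact: g0.
Qed.

Lemma increasing_monotone_beyond (R : realType) (M : R) (f : R -> R) :
  increasing_beyond M f -> monotone_beyond M f.
Proof.
move=> finc; left=> x y xM yM; rewrite le_eqVlt => /predU1P[->//|xy].
exact/ltW/finc.
Qed.

Lemma decreasing_monotone_beyond (R : realType) (M : R) (f : R -> R) :
  decreasing_beyond M f -> monotone_beyond M f.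
Proof.
move=> fdec; right=> x y xM yM; rewrite le_eqVlt => /predU1P[->//|xy].
exact/ltW/fdec.
Qed.

Lemma monotone_beyondW (R : realType) (M M' : R) (f : R -> R) :
  M <= M' -> monotone_beyond M f -> monotone_beyond M' f.
Proof.
move=> MM' fm; have sub x : x \in `]M', +oo[ -> x \in `]M, +oo[.
  by rewrite !in_itv/= !andbT; exact: le_lt_trans.
by case: fm => fm; [left|right] => x y /sub xM /sub yM; exact: fm.
Qed.

(** * Eventual monotonicity of g *)

Lemma scaled_qgamma_ratio_increasing (R : realType) (q : R) (r s : nat)
    (a : 'I_r -> R) (b : 'I_s -> R) (d : R) :
  0 < q < 1 -> (forall i, 0 <= a i) -> (forall j, 0 <= b j) -> 0 < d ->
  (forall t, 0 < t < d ->
     (wronskian (fun i => q `^ a i) (fun j => q `^ b j)).[t] < 0) ->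
  exists M, 0 <= M /\ increasing_beyond M (scaled_qgamma_ratio q a b).
Proof.
move=> hq ha hb d0 hN; have /andP[q0 q1] := hq.
have hal i : 0 < q `^ a i <= 1 by rewrite powR_itv01.
have hbe j : 0 < q `^ b j <= 1 by rewrite powR_itv01.
have [c c0 E] := scaled_qgamma_ratioE a b hq.
(* The cap at 1 keeps every factor 1 - al i * t positive. *)
have e0 : 0 < Num.min d 1 by rewrite lt_min d0 ltr01.
have [M M0 hM] := powR_eventually_lt hq e0.
exists M; split=> // x y; rewrite !in_itv/= !andbT => xM yM xy.
rewrite !E ltr_pM2l//.
(* H decreases in t and t = q^x decreases in x, so g increases. *)
apply: (qpochhammer_quot_decreasing (d := Num.min d 1)) => //.
- by rewrite ge_min lexx orbT.
- move=> u t u0 ut; rewrite lt_min => /andP[td t1].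
  have [c' /andP[uc ct] [w w0 e]] :=
    linear_quot_MVT (fun j => q `^ b j) hal u0 ut t1.
  rewrite -subr_lt0 e pmulr_llt0// hN// (lt_trans u0 uc)/=.
  exact: lt_trans ct td.
- by rewrite powR_gt0.
- exact: powR_decreasing01.
- exact: hM.
Qed.

Lemma scaled_qgamma_ratio_decreasing (R : realType) (q : R) (r s : nat)
    (a : 'I_r -> R) (b : 'I_s -> R) (d : R) :
  0 < q < 1 -> (forall i, 0 <= a i) -> (forall j, 0 <= b j) -> 0 < d ->
  (forall t, 0 < t < d ->
     0 < (wronskian (fun i => q `^ a i) (fun j => q `^ b j)).[t]) ->
  exists M, 0 <= M /\ decreasing_beyond M (scaled_qgamma_ratio q a b).
Proof.
move=> hq ha hb d0 hN.
have [|M [M0 inc]] := scaled_qgamma_ratio_increasing hq hb ha d0.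
  by move=> t td; rewrite wronskian_sym hornerN oppr_lt0 hN.
exists M; split=> //; apply: decreasing_beyondV inc => x.
  by move=> /(le_lt_trans M0); exact: scaled_qgamma_ratio_gt0.
exact: scaled_qgamma_ratio_swap.
Qed.

Lemma scaled_qgamma_ratio_monotone (R : realType) (q : R) (r s : nat)
    (a : 'I_r -> R) (b : 'I_s -> R) :
  0 < q < 1 -> (forall i, 0 <= a i) -> (forall j, 0 <= b j) ->
  exists M, 0 <= M /\ monotone_beyond M (scaled_qgamma_ratio q a b).
Proof.
move=> hq ha hb.
have hal i : 0 < q `^ a i <= 1 by rewrite powR_itv01.
have hbe j : 0 < q `^ b j <= 1 by rewrite powR_itv01.
have [N0|Nn0] :=
  eqVneq (wronskian (fun i => q `^ a i) (fun j => q `^ b j)) 0; last first.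
  have [d d0 [hN|hN]] := poly_sgn_near0 Nn0.
    have [M [M0 h]] := scaled_qgamma_ratio_decreasing hq ha hb d0 hN.
    by exists M; split=> //; exact: decreasing_monotone_beyond.
  have [M [M0 h]] := scaled_qgamma_ratio_increasing hq ha hb d0 hN.
  by exists M; split=> //; exact: increasing_monotone_beyond.
(* Here P' vanishes identically, so P is constant on (0, 1). The weak transfer lemma applies with d
   = 1, and q^x < 1 holds for all x > 0, whence M = 0. *)
exists 0; split=> //; left=> x y; rewrite !in_itv/= !andbT => x0 y0.
rewrite le_eqVlt => /predU1P[->//|xy].
have [c c0 E] := scaled_qgamma_ratioE a b hq; rewrite !E ler_pM2l//.
apply: (qpochhammer_quot_nonincreasing (d := 1)) => //.
- move=> u t u0 ut t1.
  have [c' _ [w _]] := linear_quot_MVT (fun j => q `^ b j) hal u0 ut t1.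
  by rewrite N0 horner0 mul0r -subr_le0 => ->.
- by rewrite powR_gt0//; case/andP: hq.
- exact: powR_decreasing01.
- by rewrite -[ltRHS](powRr0 q) powR_decreasing01.
Qed.

(** * Growth of f for r > s, and assembly of the claims *)

(* By the Lipschitz bound, log H(t) - log H(u) = O(q^x (y - x)) for t = q^x and
   u = q^y, which is eventually beaten by the gain (r - s) |log (1 - q)| (y - x)
   of the power of 1 - q. *)
Lemma qgamma_ratio_increasing (R : realType) (q : R) (r s : nat)
    (a : 'I_r -> R) (b : 'I_s -> R) :
  0 < q < 1 -> (forall i, 0 <= a i) -> (forall j, 0 <= b j) -> (s < r)%N ->
  exists M, 0 <= M /\ increasing_beyond M (qgamma_ratio q a b).
Proof.
move=> hq ha hb sr; have /andP[q0 q1] := hq.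
have hal i : 0 < q `^ a i <= 1 by rewrite powR_itv01.
have hbe j : 0 < q `^ b j <= 1 by rewrite powR_itv01.
have [c c0 E] := scaled_qgamma_ratioE a b hq.
have q'0 : 0 < 1 - q by rewrite subr_gt0.
pose l := - ln q; pose L := - ln (1 - q); pose k : R := r%:R - s%:R.
have l0 : 0 < l by rewrite oppr_gt0 ln_lt0// q0.
have L0 : 0 < L by rewrite oppr_gt0 ln_lt0// q'0/= gtrBl.
have k0 : 0 < k by rewrite subr_gt0 ltr_nat.
have r0 : 0 < r%:R :> R by rewrite ltr0n (leq_ltn_trans _ sr).
(* Chosen so that t < e is equivalent to 2 r l t / (1 - q) < k L. The 2 bounds 1 / (1 - t), which is
   why t < 1/2 is also required below. *)
pose e := k * L * (1 - q) / (2 * r%:R * l).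
have e0 : 0 < e by rewrite divr_gt0// !mulr_gt0.
have d0 : 0 < Num.min 2^-1 e by rewrite lt_min e0 invr_gt0 ltr0n.
have [M M0 hM] := powR_eventually_lt hq d0.
exists M; split=> // x y; rewrite !in_itv/= !andbT => xM yM xy.
rewrite !qgamma_ratio_scaled// !E.
have := hM _ xM; rewrite lt_min => /andP[t2 te].
have := powR_decreasing01 hq xy => ut.
have u0 : 0 < q `^ y by rewrite powR_gt0.
have t0 : 0 < q `^ x by rewrite powR_gt0.
have t1 : q `^ x < 1 by apply: lt_trans t2 _; rewrite invf_lt1// ltr1n.
have lip := qpochhammer_quot_lipschitz hq hal hbe (ltW u0) (ltW ut) t1.
(* This is 1 - exp(-v) <= v with v = l (y - x). *)
have tu : q `^ x - q `^ y <= q `^ x * (l * (y - x)).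
  have -> : q `^ y = q `^ x * expR (- (l * (y - x))).
    rewrite /powR gt_eqF// -expRD; congr expR; rewrite /l; ring.
  rewrite -{1}[q `^ x]mulr1 -mulrBr ler_wpM2l ?(ltW t0)// lerBlDr -lerBlDl.
  exact: expR_ge1Dx.
have pw z : (1 - q) `^ ((s%:R - r%:R) * z) = expR (k * L * z).
  by rewrite /powR gt_eqF//; congr expR; rewrite /k /L; ring.
rewrite !pw.
have Hu : 0 < qpochhammer_quot q (fun i => q `^ a i) (fun j => q `^ b j) (q `^ y).
  by rewrite qpochhammer_quot_gt0// ltW//= (lt_trans ut).
set B := r%:R * _ in lip.
apply: (@le_lt_trans _ _ (expR (k * L * x) * (c *
  (qpochhammer_quot q (fun i => q `^ a i) (fun j => q `^ b j) (q `^ y) * expR B)))).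
  by rewrite ler_wpM2l ?expR_ge0// ler_wpM2l// ltW.
move: (qpochhammer_quot _ _ _ (q `^ y)) Hu => H Hu.
have -> : expR (k * L * x) * (c * (H * expR B)) = c * H * expR (k * L * x + B).
  by rewrite expRD; ring.
(* After cancelling c H the claim is B < k L (y - x), a comparison of exponents. *)
rewrite [ltRHS]mulrC ltr_pM2l ?mulr_gt0// ltr_expR addrC -ltrBrDr -mulrBr.
have yx : 0 < y - x by rewrite subr_gt0.
apply: (@le_lt_trans _ _ (2 * r%:R * l / (1 - q) * q `^ x * (y - x))).
  have -> : 2 * r%:R * l / (1 - q) * q `^ x * (y - x) =
    r%:R * ((q `^ x * (l * (y - x))) * (2 / (1 - q))) by ring.
  rewrite /B ler_wpM2l// invfM ler_pM//.
  - by rewrite subr_ge0 ltW.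
  - by rewrite mulr_ge0// invr_ge0 ?subr_ge0 ltW.
  rewrite ler_wpM2r ?invr_ge0 ?(ltW q'0)// invf_ple ?posrE ?subr_gt0//; lra.
rewrite ltr_pM2r// mulrC -ltr_pdivlMr; last by rewrite divr_gt0// !mulr_gt0.
by rewrite invf_div mulrA.
Qed.

Theorem proposition2p1 (R : realType) (q : R) (r s : nat)
    (a : 'I_r -> R) (b : 'I_s -> R)
    (hq : 0 < q < 1)
    (ha : forall i, 0 <= a i) (hb : forall j, 0 <= b j) :
  let f := qgamma_ratio q a b in
  let g := scaled_qgamma_ratio q a b in
  (exists M : R, 0 <= M /\ monotone_beyond M f /\ monotone_beyond M g) /\
  ((s < r)%N -> exists M : R, 0 <= M /\ increasing_beyond M f) /\
  ((r < s)%N -> exists M : R, 0 <= M /\ decreasing_beyond M f) /\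
  (Upsilon q a b < 0 -> exists M : R, 0 <= M /\ increasing_beyond M g) /\
  (0 < Upsilon q a b -> exists M : R, 0 <= M /\ decreasing_beyond M g).
Proof.
move=> f g.
have finc : (s < r)%N -> exists M : R, 0 <= M /\ increasing_beyond M f.
  exact: qgamma_ratio_increasing.
have fdec : (r < s)%N -> exists M : R, 0 <= M /\ decreasing_beyond M f.
  move=> rs; have [M [M0 inc]] := qgamma_ratio_increasing hq hb ha rs.
  exists M; split=> //; apply: decreasing_beyondV inc => x.
    by move=> /(le_lt_trans M0); exact: qgamma_ratio_gt0.
  exact: qgamma_ratio_swap.
have [Mg [Mg0 gmon]] := scaled_qgamma_ratio_monotone hq ha hb.
split; last split=> //; last split=> //; last split.
- have [Mf [Mf0 fmon]] : exists M : R, 0 <= M /\ monotone_beyond M f.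
    have [rs|sr|rs] := ltngtP r s.
    + have [M [M0 h]] := fdec rs.
      by exists M; split=> //; exact: decreasing_monotone_beyond.
    + have [M [M0 h]] := finc sr.
      by exists M; split=> //; exact: increasing_monotone_beyond.
    (* For r = s the power of 1 - q is trivial, so f = g. *)
    exists Mg; split=> //; suff -> : f = scaled_qgamma_ratio q a b by [].
    have rs0 : s%:R - r%:R = 0 :> R by rewrite rs subrr.
    by apply/funext => x; rewrite /f qgamma_ratio_scaled// rs0 mul0r powRr0 mul1r.
  exists (Num.max Mf Mg); split; first by rewrite le_max Mf0.
  split; first by apply: monotone_beyondW fmon; rewrite le_max lexx.
  by apply: monotone_beyondW gmon; rewrite le_max lexx orbT.
(* [Upsilon] is the value of the Wronskian at 0, so its strict sign persists on some (0, d). *)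
- rewrite /Upsilon -wronskian_at0 -oppr_gt0 -hornerN => /poly_gt0_near0[d d0 hd].
  apply: (scaled_qgamma_ratio_increasing hq ha hb d0) => t td.
  by rewrite -oppr_gt0 -hornerN hd.
- rewrite /Upsilon -wronskian_at0 => /poly_gt0_near0[d d0 hd].
  exact: (scaled_qgamma_ratio_decreasing hq ha hb d0).
Qed.
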